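(* Fix $r\in\mathbb N\cup\{\infty\}$. Let $G$ be a finite graph and let $t$ be the smallest number such that $G$ does not contain the complete bipartite graph $K_{t,t}$ as a subgraph; then $t\le \mathrm{copw}_1(G)\le \mathrm{copw}_r(G)$. If $t\ge3$ then $\mathrm{fw}_r(G)\le \mathrm{copw}_r(G)^t$, and if $t=2$ then $\mathrm{fw}_r(G)\le a\cdot\mathrm{copw}_r(G)^t+b$ for some absolute constants $a,b$. In particular, every class of graphs with bounded expansion has bounded flip-width.
   Context: Graphs are finite, simple, undirected. Cops and Robber game of radius $r$ and width $k$: $S_0=\emptyset$, robber chooses $v_0$; in round $i\ge1$ cops announce $S_i\subseteq V(G)$, $|S_i|\le k$, robber moves from $v_{i-1}$ to $v_i$ along a path of length at most $r$ (any length if $r=\infty$, length $0$ allowed) avoiding $S_{i-1}\cap S_i$; cops win if $v_i\in S_i$. $\mathrm{copw}_r(G)$ is the least $k$ with a cops' winning strategy. Flipping a pair of sets $X,Y\subseteq V(G)$ inverts adjacency of every pair of distinct vertices $x\in X,y\in Y$. For a partition $\mathcal P$ of $V(G)$, a $\mathcal P$-flip of $G$ is a graph obtained by flipping some pairs $A,B$ of parts of $\mathcal P$ (possibly $A=B$); a $k$-flip is a $\mathcal P$-flip for some $\mathcal P$ with $|\mathcal P|\le k$. Flipper game of radius $r$ and width $k$: set $G_0=G$, runner chooses $v_0$; in round $i\ge1$ the flipper announces a $k$-flip $G_i$ of $G$, then the runner moves from $v_{i-1}$ to $v_i$ along a path of length at most $r$ in $G_{i-1}$; the flipper wins if $v_i$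 is isolated in $G_i$. $\mathrm{fw}_r(G)$ is the least $k$ such that the flipper has a winning strategy. A class has bounded flip-width if $\sup_{G\in\mathcal C}\mathrm{fw}_r(G)<\infty$ for every $r\in\mathbb N$. For a graph $G$, $\tilde\nabla_r(G)$ is the maximum of $2|E(H)|/|V(H)|$ over graphs $H$ such that some graph obtained from $H$ by replacing each edge by a path of length at most $r+1$ is a subgraph of $G$; a class has bounded expansion if $\sup_{G\in\mathcal C}\tilde\nabla_r(G)<\infty$ for every $r$.
   Formalization: The inequalities are stated for r ≥ 1 (or ∞), and the first chain and the t ≥ 3 bound for nonempty graphs: at r = 0 the robber cannot move, so copw_0 = 1 and copw_1 ≤ copw_r fails already for K_2; the empty graph has t = 1 but copw = 0. *)

(* Defs.v *)
From HB Require Import structures.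
From mathcomp Require Import all_boot.
From mathcomp Require Import boolp.

Set Implicit Arguments.
Unset Strict Implicit.
Unset Printing Implicit Defensive.

Structure sgraph (V : finType) := SGraph {
  adj :> rel V;
  adj_sym : symmetric adj;
  adj_irr : irreflexive adj }.

(* Radius r in N u {oo}: None stands for oo. *)
Definition radius := option nat.
Definition within (r : radius) (n : nat) : bool :=
  if r is Some m then n <= m else true.

Definition reach_avoid (V : finType) (E : rel V) (r : radius) (X : {set V})
    (x y : V) : Prop :=
  exists p : seq V,
    [/\ path E x p, last x p = y, within r (size p)
      & all (fun z => z \notin X) (x :: p)].

Definition reach (V : finType) (E : rel V) (r : radius) (x y : V) : Prop :=
  reach_avoid E r set0 x y.

Definition cop_strategy (V : finType) := seq ({set V} * V) -> {set V}.

Definition cop_hist (V : finType) (Ss : nat -> {set V}) (vs : nat -> V) (i : nat)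
  : seq ({set V} * V) := [seq (Ss j, vs j) | j <- iota 0 i.+1].

Definition cop_play (V : finType) (G : sgraph V) (r : radius)
    (sigma : cop_strategy V) (Ss : nat -> {set V}) (vs : nat -> V) : Prop :=
  Ss 0 = set0 /\
  forall i, Ss i.+1 = sigma (cop_hist Ss vs i) /\
            reach_avoid G r (Ss i :&: Ss i.+1) (vs i) (vs i.+1).

Definition cops_win (V : finType) (G : sgraph V) (r : radius) (k : nat) : Prop :=
  exists sigma : cop_strategy V,
    (forall h, #|sigma h| <= k) /\
    forall Ss vs, cop_play G r sigma Ss vs -> exists i, vs i.+1 \in Ss i.+1.

Lemma cops_win_ex (V : finType) (G : sgraph V) (r : radius) :
  exists k, `[< cops_win G r k >].
Proof.
exists #|V|; apply/asboolP; exists (fun _ => setT); split.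
  by move=> _; rewrite cardsT.
by move=> Ss vs [_ H]; exists 0; have [-> _] := H 0; rewrite inE.
Qed.

Definition copw (V : finType) (G : sgraph V) (r : radius) : nat :=
  ex_minn (cops_win_ex G r).

(* Flips.  For a partition P of V and a set of (unordered) pairs of    *)
(* parts, given by F (the pair {A,B} is flipped iff F A B || F B A),   *)
(* the P-flip inverts the adjacency of all distinct x in A, y in B.    *)
Definition pflip (V : finType) (G : rel V) (P : {set {set V}})
    (F : {set V} -> {set V} -> bool) : rel V :=
  fun x y => (x != y) &&
    (G x y (+) (F (pblock P x) (pblock P y) || F (pblock P y) (pblock P x))).

Definition is_kflip (V : finType) (G : rel V) (k : nat) (H : rel V) : Prop :=
  exists (P : {set {set V}}) (F : {set V} -> {set V} -> bool),
    [/\ partition P [set: V], #|P| <= k & H =2 pflip G P F].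

Definition flip_strategy (V : finType) := seq (rel V * V) -> rel V.

Definition flip_hist (V : finType) (Gs : nat -> rel V) (vs : nat -> V) (i : nat)
  : seq (rel V * V) := [seq (Gs j, vs j) | j <- iota 0 i.+1].

Definition flip_play (V : finType) (G : sgraph V) (r : radius)
    (sigma : flip_strategy V) (Gs : nat -> rel V) (vs : nat -> V) : Prop :=
  Gs 0 = G /\
  forall i, Gs i.+1 = sigma (flip_hist Gs vs i) /\
            reach (Gs i) r (vs i) (vs i.+1).

Definition isolated (V : finType) (E : rel V) (v : V) : bool :=
  [forall w, ~~ E v w].

Definition flipper_wins (V : finType) (G : sgraph V) (r : radius) (k : nat)
  : Prop :=
  exists sigma : flip_strategy V,
    (forall h, is_kflip G k (sigma h)) /\
    forall Gs vs, flip_play G r sigma Gs vs ->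
      exists i, isolated (Gs i.+1) (vs i.+1).

Lemma flipper_wins_ex (V : finType) (G : sgraph V) (r : radius) :
  exists k, `[< flipper_wins G r k >].
Proof.
exists #|V|; apply/asboolP.
pose P := preim_partition id [set: V].
pose F := fun A B : {set V} => [exists x in A, exists y in B, G x y].
have hP : partition P [set: V] by exact: preim_partitionP.
have pb x y : (y \in pblock P x) = (x == y).
  by rewrite (@pblock_equivalence_partition _ (fun x y => id x == id y))
     ?inE //; split => // /eqP ->.
have hF x y : F (pblock P x) (pblock P y) = G x y.
  apply/existsP/idP => [[x' /andP[hx /existsP[y' /andP[hy hG]]]]|hG].
    by move: hx hy; rewrite !pb => /eqP ex /eqP ey; rewrite ex ey.
  by exists x; rewrite pb eqxx /=; apply/existsP; exists y; rewrite pb eqxx.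
exists (fun _ => pflip G P F); split.
  move=> _; exists P, F; split=> //.
  rewrite /P /preim_partition /equivalence_partition.
  by rewrite (leq_trans (leq_imset_card _ _)) // cardsT.
move=> Gs vs [_ H]; exists 0; have [-> _] := H 0.
apply/forallP => w; rewrite /pflip !hF (adj_sym G w).
by case: (G _ _); rewrite ?andbF.
Qed.

Definition fw (V : finType) (G : sgraph V) (r : radius) : nat :=
  ex_minn (flipper_wins_ex G r).

Definition has_Ktt (V : finType) (G : sgraph V) (t : nat) : bool :=
  [exists A : {set V}, exists B : {set V},
     [&& [disjoint A & B], #|A| == t, #|B| == t &
         [forall a in A, forall b in B, G a b]]].

Lemma Ktt_free_ex (V : finType) (G : sgraph V) : exists t, ~~ has_Ktt G t.
Proof.
exists #|V|.+1; apply/negP => /existsP[A /existsP[B /and4P[_ /eqP hA _ _]]].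
by have := max_card A; rewrite hA ltnn.
Qed.

Definition Ktt_number (V : finType) (G : sgraph V) : nat :=
  ex_minn (Ktt_free_ex G).

Definition nedges (W : finType) (H : rel W) : nat :=
  #|[set [set x; y] | x in [set: W], y in [set: W] & H x y]|.

(* Some graph obtained from H by replacing each edge by a path of length
   at most r+1 is a subgraph of G: an injective map phi of the branch
   vertices and, for each edge uv of H, a simple path Q u v in G from
   phi u to phi v of length <= r+1, whose internal vertices avoid the
   branch vertices and the internal vertices of paths of other edges. *)
Definition internal (V : finType) (Q : seq V) (y : V) : {set V} :=
  [set z in Q | z != y].

Definition shallow_top_minor (V W : finType) (r : nat) (G : sgraph V)
    (H : sgraph W) : Prop :=
  exists (phi : W -> V) (Q : W -> W -> seq V),
    [/\ injective phi,
        (forall u v, H u v ->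
           [/\ path G (phi u) (Q u v), last (phi u) (Q u v) = phi v,
               size (Q u v) <= r.+1, uniq (phi u :: Q u v)
             & [disjoint internal (Q u v) (phi v) & [set phi w | w in W]]])
      & (forall u v u' v', H u v -> H u' v' -> [set u; v] != [set u'; v'] ->
           [disjoint internal (Q u v) (phi v) & internal (Q u' v') (phi v')])].

Definition graph_class := forall V : finType, sgraph V -> Prop.

(* sup over C of tilde-nabla_r is finite, for every r *)
Definition bounded_expansion (C : graph_class) : Prop :=
  forall r : nat, exists c : nat,
    forall (V : finType) (G : sgraph V), C V G ->
      forall (W : finType) (H : sgraph W), shallow_top_minor r G H ->
        2 * nedges H <= c * #|W|.

Definition bounded_flip_width (C : graph_class) : Prop :=
  forall r : nat, exists c : nat,
    forall (V : finType) (G : sgraph V), C V G -> fw G (Some r) <= c.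

(* Main.v *)
Require Import Defs.
From HB Require Import structures.
From mathcomp Require Import all_boot.
From mathcomp Require Import boolp zify.

Set Implicit Arguments.
Unset Strict Implicit.
Unset Printing Implicit Defensive.

(* A strategy of the cops becomes one of the flipper by isolating the vertices of the cops' set
   [S], that is, by passing to [cut_at S].  This is a flip of the partition into the singletons
   of [S] and the classes of equal neighbourhood in [S], and [K_{t,t}]-freeness bounds the number
   of classes.  Conversely, in [K_{t-1,t-1}] the robber always has a free vertex to move to
   against [t - 1] cops of speed 1.

   For bounded expansion, the path from topological minors to the cops' strategy goes through
   an ordering of the vertices.  Given a set [S], take a maximum system of disjoint short paths
   between pairs of vertices of [S], with set of interior vertices [M].  The density bound makes
   [M] small and gives a large independent set [I] of vertices of low degree for this system.  A
   maximum system of disjoint short paths from [I] to [M] is again sparse, so some [v] in [I]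
   starts few of them, and the paths it starts, together with its neighbours in the first
   system, meet all short paths from [v] to the rest of [S].  Removing such vertices one by one
   gives the ordering; iterating the separators bounds the weakly reachable sets, and the cops
   win by occupying (a superset of) the set weakly reachable from the robber's last position. *)

(** * Elementary counting *)

Lemma leq_card_bigcup (I T : finType) (D : {set I}) (F : I -> {set T}) :
  #|\bigcup_(i in D) F i| <= \sum_(i in D) #|F i|.
Proof.
elim/big_ind2: _ => [|A a B b Aa Bb|//]; first by rewrite cards0.
by apply: leq_trans (leq_card_setU _ _) (leq_add Aa Bb).
Qed.

Lemma exists_subset_card (T : finType) (A : {set T}) n :
  n <= #|A| -> exists2 B : {set T}, B \subset A & #|B| = n.
Proof.
case/card_geqP => s [us ss sA]; exists [set x in s]; last by rewrite cardsE (card_uniqP us).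
by apply/subsetP => x; rewrite inE => /sA.
Qed.

Lemma ffact_leq_exp n m : n ^_ m <= n ^ m.
Proof.
elim: m n => [//|m IH] n; rewrite ffactnS expnS leq_mul2l.
by rewrite (leq_trans (IH _)) ?orbT //; case: m {IH} => // m; rewrite leq_exp2r // leq_pred.
Qed.

Lemma fact_geq2 n : 1 < n -> 2 <= n`!.
Proof. by move=> n1; rewrite -[2]/2`!; apply: leq_fact. Qed.

(** * The games *)

Section CopsAndRobber.
Variables (V : finType) (G : sgraph V).

Lemma cops_win_copw r : cops_win G r (copw G r).
Proof. by rewrite /copw; case: ex_minnP => k /asboolP. Qed.

Lemma copw_leq r k : cops_win G r k -> copw G r <= k.
Proof. by rewrite /copw => h; case: ex_minnP => j _; apply; apply/asboolP. Qed.

Lemma fw_leq r k : flipper_wins G r k -> fw G r <= k.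
Proof. by rewrite /fw => h; case: ex_minnP => j _; apply; apply/asboolP. Qed.

Lemma cops_win_radius r r' k :
  (forall n, within r' n -> within r n) -> cops_win G r k -> cops_win G r' k.
Proof.
move=> rr' [sigma [hk win]]; exists sigma; split=> // Ss vs [S0 play].
apply: win; split=> // i; have [-> [p [? ? ? ?]]] := play i.
by split=> //; exists p; split=> //; apply: rr'.
Qed.

Lemma cop_histS (Ss : nat -> {set V}) (vs : nat -> V) i :
  cop_hist Ss vs i.+1 = rcons (cop_hist Ss vs i) (Ss i.+1, vs i.+1).
Proof.
by rewrite /cop_hist -[i.+2]addn1 iotaD map_cat cats1.
Qed.

(** The robber always moves to a vertex of [X] outside the announced set. A move along at most one
    edge visits only its ends, the first outside the current cops' set and the second outside the
    next one, so it is legal. *)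
Lemma robber_haven (X : {set V}) (x0 : V) k :
  x0 \in X ->
  (forall (S : {set V}) x, #|S| <= k -> x \in X ->
     exists y, [/\ y \in X, y \notin S & (x == y) || G x y]) ->
  ~ cops_win G (Some 1) k.
Proof.
move=> x0X haven [sigma [hk win]].
have esc (S : {set V}) x : exists y, #|S| <= k -> x \in X ->
    [/\ y \in X, y \notin S & (x == y) || G x y].
  have [/andP[Sk xX]|nSx] := boolP ((#|S| <= k) && (x \in X)).
    by have [y Py] := haven S x Sk xX; exists y.
  by exists x => Sk xX; rewrite Sk xX in nSx.
have /choice [nx nxP] : forall Sx : {set V} * V, exists y,
    #|Sx.1| <= k -> Sx.2 \in X ->
    [/\ y \in X, y \notin Sx.1 & (Sx.2 == y) || G Sx.2 y].
  by move=> [S x]; apply: esc.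
(* The cops' strategy sees the whole history, so the play is built as a sequence of histories [H n];
   [d] is both the initial entry and the default of [last]. *)
pose d := (@set0 V, x0).
pose step h := rcons h (sigma h, nx (sigma h, (last d h).2)).
pose H n := iter n step [:: d].
pose Ss n := (last d (H n)).1; pose vs n := (last d (H n)).2.
have HS n : H n.+1 = rcons (H n) (sigma (H n), nx (sigma (H n), vs n)) by [].
have histE n : cop_hist Ss vs n = H n.
  elim: n => [//|n IH]; rewrite cop_histS IH HS.
  by rewrite /Ss /vs HS last_rcons.
have SsS n : Ss n.+1 = sigma (H n) by rewrite /Ss HS last_rcons.
have vsS n : vs n.+1 = nx (Ss n.+1, vs n) by rewrite {1}/vs HS last_rcons SsS.
have inv n : vs n \in X /\ vs n \notin Ss n.
  elim: n => [|n [vX _]]; first by rewrite /vs /Ss /= inE.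
  by rewrite vsS; case: (nxP (Ss n.+1, vs n)) => //=; rewrite SsS.
have [i] : exists i, vs i.+1 \in Ss i.+1; last first.
  by case: (inv i.+1) => _ /negP.
apply: win; split=> // i; split; first by rewrite histE SsS.
have [vX vS] := inv i; have [_ vS'] := inv i.+1.
have : (vs i == vs i.+1) || G (vs i) (vs i.+1).
  by rewrite vsS; case: (nxP (Ss i.+1, vs i)) => //=; rewrite SsS.
case/orP=> [/eqP <-|adj].
  by exists [::]; split=> //=; rewrite inE (negPf vS).
exists [:: vs i.+1]; split=> //=; first by rewrite adj.
by rewrite !inE (negPf vS) (negPf vS') andbF.
Qed.

(** Suppose there are at most [s] cops. If one of them is announced on the robber's vertex, at most
    [s - 1] remain for the opposite side of the [K_{s,s}], which has [s] vertices; one of these is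
    free. For [s = 0] there are no cops and the robber stays in place. *)
Lemma has_Ktt_cops s k :
  0 < #|V| -> has_Ktt G s -> cops_win G (Some 1) k -> s < k.
Proof.
move=> V0 /existsP[A /existsP[B /and4P[dAB /eqP cA /eqP cB /forall_inP KAB]]] win.
rewrite ltnNge; apply/negP => ks.
case: s => [|s] in cA cB ks *.
  have /card_gt0P [x0 _] := V0.
  apply: (@robber_haven setT x0 k) win => [|S x Sk _]; first by rewrite inE.
  exists x; split; rewrite ?inE ?eqxx //.
  by move: (leq_trans Sk ks); rewrite leqn0 cards_eq0 => /eqP ->; rewrite inE.
have /card_gt0P [x0 x0A] : 0 < #|A| by rewrite cA.
apply: (@robber_haven (A :|: B) x0 k) win => [|S x Sk xAB]; first by rewrite inE x0A.
have [xS|xS] := boolP (x \in S); last by exists x; rewrite eqxx.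
have escape (D : {set V}) : #|D| = s.+1 -> x \notin D -> exists2 y, y \in D & y \notin S.
  move=> cD xD; apply/subsetPn/negP => DS.
  have : #|x |: D| <= #|S| by apply: subset_leq_card; rewrite subUset sub1set xS.
  rewrite cardsU1 xD cD; lia.
have adjAB a b : a \in A -> b \in B -> G a b by move=> /KAB /forall_inP; apply.
case/setUP: xAB => [xA|xB].
  have [|y yB yS] := escape B cB; first by rewrite (disjointFr dAB xA).
  by exists y; rewrite !inE yB yS (adjAB x y) ?orbT.
have [|y yA yS] := escape A cA; first by rewrite (disjointFl dAB xB).
by exists y; rewrite !inE yA yS adj_sym (adjAB y x) ?orbT.
Qed.

Lemma Ktt_number_leq_copw1 : 0 < #|V| -> Ktt_number G <= copw G (Some 1).
Proof.
move=> V0; rewrite /Ktt_number; case: ex_minnP => [[//|t] _ tmin].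
apply: (has_Ktt_cops V0 _ (cops_win_copw (Some 1))).
by apply: contraT => /tmin; rewrite ltnn.
Qed.

Lemma copw1_leq r : r <> Some 0 -> copw G (Some 1) <= copw G r.
Proof.
move=> r0; apply: copw_leq; apply: cops_win_radius (cops_win_copw r).
by case: r r0 => [[|r]|] //= _ [|[]].
Qed.

(** * Isolating a set of vertices by a flip *)

Definition cut_at (S : {set V}) (x y : V) : bool :=
  [&& G x y, x \notin S & y \notin S].

Definition trace (S : {set V}) (v : V) : {set V} := [set s in S | G v s].

Definition cut_type (S : {set V}) (v : V) : V + {set V} :=
  if v \in S then inl v else inr (trace S v).

Definition outer_traces (S : {set V}) : {set {set V}} := trace S @: ~: S.

Definition cut_partition (S : {set V}) := preim_partition (cut_type S) [set: V].

Lemma card_cut_partition (S : {set V}) : #|cut_partition S| <= #|S| + #|outer_traces S|.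
Proof.
rewrite /cut_partition /preim_partition /equivalence_partition.
have -> : [set [set y in [set: V] | cut_type S x == cut_type S y] | x in [set: V]]
   = (fun a => [set y | a == cut_type S y]) @: (cut_type S @: [set: V]).
  rewrite -imset_comp; apply: eq_imset => x /=.
  by apply/setP => y; rewrite !inE.
apply: leq_trans (leq_imset_card _ _) _.
apply: leq_trans (_ : #|inl @: S :|: inr @: outer_traces S| <= _).
  apply: subset_leq_card; apply/subsetP => _ /imsetP[x _ ->].
  rewrite /cut_type inE; case: ifP => xS; first by rewrite imset_f.
  by apply/orP; right; do 2!apply: imset_f; rewrite inE xS.
by rewrite cardsU (leq_trans (leq_subr _ _)) // leq_add // leq_imset_card.
Qed.

Lemma cut_at_kflip (S : {set V}) k :
  #|S| + #|outer_traces S| <= k -> is_kflip G k (cut_at S).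
Proof.
move=> Sk; pose P := cut_partition S.
(* [F] marks the pairs of a singleton in [S] and a part adjacent to it. Adjacency to a vertex of [S]
   is constant on each part, because equal types have equal traces. *)
pose F := fun A B : {set V} =>
  [exists x in A, exists y in B, (x \in S) && G x y].
have pb x y : (y \in pblock P x) = (cut_type S x == cut_type S y).
  rewrite (@pblock_equivalence_partition _
    (fun x y => cut_type S x == cut_type S y)) ?inE //.
  by split => // /eqP ->.
have hF x y : F (pblock P x) (pblock P y) = (x \in S) && G x y.
  apply/exists_inP/idP => [[x' + /exists_inP[y' + /andP[x'S Gxy]]]|hG]; last first.
    by exists x; rewrite ?pb //; apply/exists_inP; exists y; rewrite ?pb.
  rewrite !pb /cut_type x'S; case: ifP => // xS /eqP[xx']; subst x'.
  case: ifP => yS; case: ifP => y'S // /eqP []; first by move->.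
  by move/setP/(_ x); rewrite !inE xS /= !(adj_sym G _ x) Gxy.
exists P, F; split; first exact: preim_partitionP.
  exact: leq_trans (card_cut_partition S) Sk.
move=> x y; rewrite /pflip /cut_at !hF (adj_sym G y).
have [->|_] /= := eqVneq x y; first by rewrite adj_irr.
by case: (G x y); case: (x \in S); case: (y \in S).
Qed.

Lemma isolated_cut_at (S : {set V}) v : v \in S -> isolated (cut_at S) v.
Proof. by move=> vS; apply/forallP => w; rewrite /cut_at vS andbF. Qed.

Lemma reach_cut_at (S X : {set V}) r x y : x \notin S ->
  reach (cut_at S) r x y -> reach_avoid G r (S :&: X) x y.
Proof.
move=> xS [p [pp py pr _]]; exists p; split=> //.
  by apply: sub_path pp => a b /and3P[].
rewrite /= !inE (negPf xS) /=; apply/allP => z zp; rewrite inE negb_and.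
apply/orP; left; elim: p x xS {py pr} pp zp => //= a p IH x _.
case/andP => /and3P[_ _ aS] pp; rewrite inE => /predU1P[->//|].
exact: (IH a).
Qed.

(* The runner of the flipper game, as long as it is not isolated, makes legal robber moves:
   a vertex that is not isolated in [cut_at S] lies outside [S], and so do all vertices
   that can be reached from it. *)
Lemma cops_win_flipper_wins r k m :
  (forall S : {set V}, #|S| <= k -> #|S| + #|outer_traces S| <= m) ->
  cops_win G r k -> flipper_wins G r m.
Proof.
move=> km [sigma [hk win]].
(* [rec] replays the cops' game from the runner's positions alone; an empty history yields the
   initial set [S_0], which is empty. *)
pose rec := foldl (fun h v => rcons h (if nilp h then set0 else sigma h, v)) [::].
pose S_ l := sigma (rec l).
exists (fun h => cut_at (S_ (map snd h))); split.
  by move=> h; apply/cut_at_kflip/km/hk.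
move=> Gs vs [G0 play].
pose Ss i := if i is j.+1 then S_ [seq vs j | j <- iota 0 i] else set0.
have GsS i : Gs i.+1 = cut_at (Ss i.+1).
  have [-> _] := play i; congr (cut_at (S_ _)).
  by rewrite /flip_hist -map_comp; apply: eq_map.
have histE i : cop_hist Ss vs i = rec [seq vs j | j <- iota 0 i.+1].
  elim: i => [//|i IH].
  rewrite cop_histS IH -[i.+2]addn1 (iotaD 0 i.+1 1) map_cat cats1 /rec foldl_rcons.
  by rewrite -/rec -IH {2}/cop_hist /= /S_ IH.
have [//|/forallNP ni] := pselect (exists i, isolated (Gs i.+1) (vs i.+1)).
exfalso.
have notS i : vs i \notin Ss i.
  case: i => [|i]; first by rewrite inE.
  by apply/negP => vS; apply: (ni i); rewrite GsS; apply: isolated_cut_at.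
have [i vS] : exists i, vs i.+1 \in Ss i.+1; last first.
  by have := notS i.+1; rewrite vS.
apply: win; split=> // i; split; first by rewrite histE.
have [_ mv] := play i; case: i mv => [|i] mv; last first.
  by rewrite GsS in mv; apply: reach_cut_at mv; apply: notS.
rewrite G0 in mv; case: mv => p [pp py pr _]; exists p; split=> //.
by apply/allP => z _; rewrite !inE.
Qed.

Lemma outer_traces_pow (S : {set V}) : #|outer_traces S| <= 2 ^ #|S|.
Proof.
rewrite -card_powerset; apply: subset_leq_card.
apply/subsetP => _ /imsetP[v _ ->]; rewrite inE.
by apply/subsetP => s; rewrite inE => /andP[].
Qed.

(** This crude count of the traces serves bounded expansion, where any bound in terms of [k] is
    enough. *)
Lemma fw_leq_exp r k : cops_win G r k -> fw G r <= k + 2 ^ k.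
Proof.
move=> win; apply/fw_leq/(cops_win_flipper_wins _ win) => S Sk.
by rewrite leq_add // (leq_trans (outer_traces_pow S)) // leq_pexp2l.
Qed.

(* The second term counts the traces of size at least [t]: each contains a set of [t] vertices
   of [S], and such a set has fewer than [t] common neighbours outside [S]. *)
Lemma card_outer_traces (S : {set V}) t : ~~ has_Ktt G t ->
  #|outer_traces S| <= \sum_(i < t) 'C(#|S|, i) + t.-1 * 'C(#|S|, t).
Proof.
move=> Kfree.
pose small := [set A : {set V} | (A \subset S) && (#|A| < t)].
pose Y := [set v in ~: S | t <= #|trace S v|].
pose D := [set A : {set V} | A \subset S & #|A| == t].
have sub : outer_traces S \subset small :|: trace S @: Y.
  apply/subsetP => _ /imsetP[v vS ->]; rewrite inE.
  have [tv|vt] := leqP t #|trace S v|.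
    by apply/orP; right; apply: imset_f; rewrite inE vS.
  by rewrite inE vt andbT; apply/orP; left; apply/subsetP => s; rewrite inE => /andP[].
apply: leq_trans (subset_leq_card sub) _.
apply: leq_trans (leq_card_setU _ _) _; apply: leq_add.
  rewrite /small; elim: t {Kfree small Y D sub} => [|t IH].
    by rewrite (eq_card0 (A := _)) // => A; rewrite inE ltn0 andbF.
  rewrite big_ord_recr /= -cards_draws.
  apply: leq_trans (leq_add IH (leqnn _)); apply: leq_trans (leq_card_setU _ _).
  apply: subset_leq_card; apply/subsetP => A; rewrite !inE ltnS leq_eqVlt.
  by case/andP => -> /=; rewrite orbC.
apply: leq_trans (leq_imset_card _ _) _.
have Ysub : Y \subset \bigcup_(A in D) [set v in ~: S | A \subset trace S v].
  apply/subsetP => v; rewrite inE => /andP[vS tv].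
  have [A Av cA] := exists_subset_card tv; apply/bigcupP; exists A; last by rewrite inE vS.
  rewrite inE cA eqxx andbT (subset_trans Av) //.
  by apply/subsetP => s; rewrite inE => /andP[].
apply: leq_trans (subset_leq_card Ysub) _; apply: leq_trans (leq_card_bigcup _ _) _.
rewrite mulnC -cards_draws -sum_nat_const; apply: leq_sum => A; rewrite inE => /andP[AS cA].
(* Every graph contains [K_{0,0}], given by two empty sets. *)
have t0 : 0 < t.
  case: t Kfree {Y D Ysub sub cA small} => // /negP[].
  apply/existsP; exists set0; apply/existsP; exists set0.
  by rewrite !cards0 -setI_eq0 set0I !eqxx; apply/forall_inP => a; rewrite inE.
rewrite -ltnS prednK // ltnNge; apply: contra Kfree => /exists_subset_card[B Bsub cB].
have Bout v : v \in B -> v \notin S /\ A \subset trace S v.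
  by move/(subsetP Bsub); rewrite !inE => /andP[].
apply/existsP; exists A; apply/existsP; exists B; rewrite cA cB eqxx /=.
apply/andP; split.
  rewrite -setI_eq0; apply/eqP/setP => v; rewrite !inE; apply/negP => /andP[vA /Bout[/negP[]]].
  exact: (subsetP AS).
apply/forall_inP => a aA; apply/forall_inP => b /Bout[_ /subsetP/(_ a aA)].
by rewrite inE adj_sym => /andP[].
Qed.

End CopsAndRobber.

(** * Arithmetic of the bound on the number of parts *)

Lemma sum_bin_leq k t : 1 < k -> 1 < t -> \sum_(i < t) 'C(k, i) <= k ^ t.-1 + 1.
Proof.
move=> k1; case: t => [|[|t]] // _; elim: t => [|t IH].
  by rewrite !big_ord_recr big_ord0 /= bin0 bin1 expn1; lia.
rewrite big_ord_recr /=; apply: leq_trans (leq_add IH (leqnn _)) _ => /=.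
have : 'C(k, t.+2) * 2 <= k ^ t.+2.
  apply: leq_trans (_ : 'C(k, t.+2) * t.+2`! <= _); first by apply: leq_mul => //; apply: fact_geq2.
  by rewrite bin_ffact ffact_leq_exp.
have : 2 * k ^ t.+1 <= k ^ t.+2 by rewrite (expnS k t.+1) leq_mul2r k1 orbT.
lia.
Qed.

(** Three quantities are each at most a third of [k ^ t]: [k ^ t.-1], since [k >= 3];
    [t.-1 * 'C(k, t)], since [3 * t.-1 <= t!] for [t >= 3]; and the remainder [k + 1], which is at
    most [k ^ 2 <= k ^ t.-1]. *)
Lemma card_cut_leq_exp k t : 2 < t -> t <= k ->
  k + (\sum_(i < t) 'C(k, i) + t.-1 * 'C(k, t)) <= k ^ t.
Proof.
move=> t3 tk.
have : \sum_(i < t) 'C(k, i) <= k ^ t.-1 + 1 by apply: sum_bin_leq; lia.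
have : 3 * (t.-1 * 'C(k, t)) <= k ^ t.
  have tf : 3 * t.-1 <= t`!.
    case: t t3 {tk} => [|[|[|t]]] // _; rewrite /= !factS.
    by have := fact_gt0 t; nia.
  by rewrite (leq_trans _ (ffact_leq_exp k t)) // -bin_ffact mulnA mulnC leq_mul.
have : 3 * k ^ t.-1 <= k ^ t by rewrite -{2}(prednK (ltnW (ltnW t3))) expnS leq_mul2r; lia.
have : k ^ 2 <= k ^ t.-1 by apply: leq_pexp2l; lia.
rewrite -mulnn; nia.
Qed.

(** * Separators from sparse shallow topological minors *)

Lemma sum_card_fibers (I T : finType) (S : {set T}) (E : {set I}) (f : I -> T) :
  \sum_(v in S) #|[set e in E | f e == v]| <= #|E|.
Proof.
have -> : \sum_(v in S) #|[set e in E | f e == v]|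
    = \sum_(v in S) \sum_(e in E) (f e == v).
  apply: eq_bigr => v _; rewrite -sum1_card big_mkcond [RHS]big_mkcond /=.
  by apply: eq_bigr => e _; rewrite !inE; case: (e \in E); case: (f e == v).
rewrite exchange_big /= -sum1_card; apply: leq_sum => e _.
rewrite -big_mkcondr /= sum1_card; apply: leq_trans (_ : #|[set f e]| <= 1); last by rewrite cards1.
by apply: subset_leq_card; apply/subsetP => v; rewrite !inE unfold_in => /andP[_ /eqP ->].
Qed.

Lemma exists_leq_average (T : finType) (S : {set T}) (f : T -> nat) c :
  S != set0 -> \sum_(v in S) f v <= c * #|S| -> exists2 v, v \in S & f v <= c.
Proof.
move=> S0 fc; apply/exists_inP; apply: contraT; rewrite negb_exists_in => /forall_inP big.
have : \sum_(v in S) c.+1 <= \sum_(v in S) f v.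
  by apply: leq_sum => v /big; rewrite -ltnNge.
rewrite sum_nat_const; move: S0; rewrite -card_gt0; nia.
Qed.

Lemma card_below_average (T : finType) (S : {set T}) (f : T -> nat) c :
  \sum_(v in S) f v <= c * #|S| -> #|S| <= 2 * #|[set v in S | f v <= 2 * c]|.
Proof.
move=> fc; set L := [set v in S | _].
have big : \sum_(v in S :\: L) (2 * c).+1 <= \sum_(v in S :\: L) f v.
  by apply: leq_sum => v; rewrite !inE negb_and => /andP[+ vS]; rewrite vS -ltnNge.
have := leq_trans big (leq_trans (leq_addl _ _) (leq_trans (eq_leq (esym (big_setID L _))) fc)).
rewrite sum_nat_const -(cardsID L S).
have -> : S :&: L = L by apply/setIidPr/subsetP => v /setIdP[].
by nia.
Qed.

(** * Systems of disjoint short paths *)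

Section Linkages.
Variables (V : finType) (G : sgraph V).
Implicit Types (A S : {set V}) (D E : {set V * V}) (s : V -> V -> seq V).

Lemma path_rcons_rev x y q : path G x (rcons q y) -> path G y (rcons (rev q) x).
Proof.
move=> xy; have := rev_path G x (rcons q y).
rewrite last_rcons belast_rcons rev_cons => ->.
by rewrite (@eq_path _ _ G) // => a b; apply: adj_sym.
Qed.

Lemma path_shorten x y q : x != y -> path G x (rcons q y) ->
  exists q', [/\ path G x (rcons q' y), uniq q', size q' <= size q & {subset q' <= q}].
Proof.
move=> xy pq; have := last_rcons x q y; case/shortenP: pq => p.
case/lastP: p => [|p z] /= pp; first by move=> _ _ e; rewrite e eqxx in xy.
rewrite mem_rcons inE rcons_uniq last_rcons => /and3P[_ zp up] sub e; subst z.
have sub' : {subset p <= q}.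
  move=> a ap; have := sub a; rewrite !mem_rcons !inE ap orbT => /(_ isT).
  by case: eqVneq => // e; rewrite -e ap in zp.
by exists p; split=> //; apply: uniq_leq_size.
Qed.

Lemma path_prefix x y q z : path G x (rcons q y) -> z \in q ->
  exists q', [/\ path G x (rcons q' z), size q' < size q & {subset q' <= q}].
Proof.
move=> + zq; case/splitPr: zq => p1 p2; rewrite rcons_cat /= -cat_rcons cat_path.
case/andP => pp _; exists p1; split=> //.
  by rewrite size_cat /= addnS ltnS leq_addr.
by move=> a; rewrite mem_cat => ->.
Qed.

(** [s x y] lists only the interior vertices, so paths may share ends. Excluding [(y, x)] makes [E]
    hold each unordered pair once and no loop. *)
Definition linkage n A D E s : Prop :=
  [/\ E \subset D,
      forall x y, (x, y) \in E ->
        [/\ (y, x) \notin E, path G x (rcons (s x y) y), uniq (s x y),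
            size (s x y) <= n & {subset s x y <= A}]
    & forall x y x' y' z, (x, y) \in E -> (x', y') \in E ->
        z \in s x y -> z \in s x' y' -> (x, y) = (x', y')].

Lemma linkage_add n A D E s x y q :
  linkage n A D E s -> (x, y) \in D -> x != y -> (y, x) \notin E ->
  path G x (rcons q y) -> size q <= n -> {subset q <= A} ->
  (forall a b z, (a, b) \in E -> z \in q -> z \notin s a b) ->
  exists s', linkage n A D ((x, y) |: E) s'.
Proof.
move=> [ED Es Edisj] xyD xy yxE pq sq qA qE.
have [q' [pq' uq' sq' q'q]] := path_shorten xy pq.
have [xyE|xyE] := boolP ((x, y) \in E).
  by exists s; have -> : (x, y) |: E = E by apply/setUidPr; rewrite sub1set.
pose s' a b := if (a, b) == (x, y) then q' else s a b.
have s'E a b : (a, b) \in E -> s' a b = s a b.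
  by rewrite /s'; case: eqP => // ->; rewrite (negPf xyE).
have s'xy : s' x y = q' by rewrite /s' eqxx.
exists s'; split; first by rewrite subUset sub1set xyD.
  move=> a b /setU1P[[-> ->]|abE].
    rewrite s'xy; split=> //; [|exact: leq_trans sq' sq|by move=> z /q'q /qA].
    by rewrite !inE (negPf yxE) xpair_eqE eq_sym (negPf xy).
  rewrite s'E //; have [baE ? ? ? ?] := Es a b abE; split=> //.
  rewrite !inE (negPf baE) orbF; apply: contra yxE => /eqP[<- <-] //.
move=> a b a' b' z /setU1P[[-> ->]|abE] /setU1P[[-> ->]|abE'] //.
- rewrite s'xy (s'E a' b') // => /q'q zq zs.
  by have := qE _ _ _ abE' zq; rewrite zs.
- rewrite s'xy (s'E a b) // => zs /q'q zq.
  by have := qE _ _ _ abE zq; rewrite zs.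
- rewrite !s'E //; exact: Edisj.
Qed.

Lemma exists_max_linkage n A D : exists E s, linkage n A D E s /\
  forall x y q, (x, y) \in D -> x != y -> path G x (rcons q y) -> size q <= n ->
    {subset q <= A} -> (forall a b z, (a, b) \in E -> z \in q -> z \notin s a b) ->
    ((x, y) \in E) || ((y, x) \in E).
Proof.
pose P E := `[< exists s, linkage n A D E s >].
have P0 : P set0.
  apply/asboolP; exists (fun _ _ => [::]); split; first exact: sub0set.
    by move=> x y; rewrite inE.
  by move=> x y x' y' z; rewrite inE.
case: (@arg_maxnP _ set0 P (fun E => #|E|) P0) => E /asboolP[s lE] maxE.
exists E, s; split=> // x y q xyD xy pq sq qA qE; apply: contraT.
rewrite negb_or => /andP[xyE yxE].
have [s' lE'] := linkage_add lE xyD xy yxE pq sq qA qE.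
have /maxE /= : P ((x, y) |: E) by apply/asboolP; exists s'.
by rewrite cardsU1 xyE ltnn.
Qed.

(** The graph on [T] with edges [E] is a shallow topological minor realised by the linkage:
    interiors lie in [A], away from the branch vertices, and [n] interior vertices give length
    [n + 1]. *)
Lemma linkage_density c m n A D E s T :
  (forall (W : finType) (H : sgraph W), shallow_top_minor m G H -> 2 * nedges H <= c * #|W|) ->
  n <= m -> D \subset setX T T -> [disjoint A & T] -> linkage n A D E s ->
  2 * #|E| <= c * #|T|.
Proof.
move=> dens nm DT AT [ED Es Edisj].
pose W : finType := {x | x \in T}.
have ET x y : (x, y) \in E -> (x \in T) && (y \in T).
  by move/(subsetP ED)/(subsetP DT); rewrite inE.
have AnT z : z \in A -> z \notin T by move=> zA; rewrite (disjointFr AT zA).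
pose adjW (u v : W) := ((val u, val v) \in E) || ((val v, val u) \in E).
have symW : symmetric adjW by move=> u v; rewrite /adjW orbC.
have irrW : irreflexive adjW.
  move=> u; rewrite /adjW orbb; apply/negP => uE; have [] := Es _ _ uE.
  by rewrite uE.
pose H := SGraph symW irrW.
have HE : #|E| <= nedges H.
  pose edge (e : V * V) := [set w : W | (val w == e.1) || (val w == e.2)].
  have edge_inj : {in E &, injective edge}.
    move=> [x y] [x' y'] xyE xyE' /setP eq_edge.
    have /andP[xT yT] := ET _ _ xyE; have /andP[xT' yT'] := ET _ _ xyE'.
    have := eq_edge (Sub x xT); have := eq_edge (Sub y yT).
    rewrite !inE /= !eqxx orbT => /esym/orP ey /esym/orP ex.
    have [yxE _ _ _ _] := Es _ _ xyE.
    case: ex ey => /eqP ex [] /eqP ey; rewrite ?ex ?ey // in xyE yxE *.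
    - by rewrite xyE in yxE.
    - by rewrite xyE' in yxE.
    - by rewrite xyE in yxE.
  rewrite -(card_in_imset edge_inj); apply: subset_leq_card.
  apply/subsetP => _ /imsetP[[x y] xyE ->].
  have /andP[xT yT] := ET _ _ xyE.
  apply/imset2P; exists (Sub x xT) (Sub y yT); rewrite ?inE //=.
    by rewrite /adjW /= xyE.
  by apply/setP => w; rewrite !inE -!(inj_eq val_inj) /=.
suff densH : 2 * nedges H <= c * #|W|.
  have cW : #|W| = #|T| by rewrite card_sig.
  by rewrite -cW; apply: leq_trans densH; rewrite leq_mul2l HE orbT.
(* Edges of [H] have both orientations while [s] is meaningful for only one, so the other traverses
   the path backwards. *)
apply: dens; pose inner x y := if (x, y) \in E then s x y else rev (s y x).
have innerP u v : H u v -> [/\ path G (val u) (rcons (inner (val u) (val v)) (val v)),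
    uniq (inner (val u) (val v)), size (inner (val u) (val v)) <= n,
    {subset inner (val u) (val v) <= A}
  & exists x y, [/\ (x, y) \in E, [set val u; val v] = [set x; y]
                  & inner (val u) (val v) =i s x y]].
  rewrite /H /= /adjW /inner; case: ifP => [uvE _|_ /= vuE].
    have [_ ? ? ? ?] := Es _ _ uvE; split=> //.
    by exists (val u), (val v).
  have [_ pvu ? ? sA] := Es _ _ vuE; split; rewrite ?rev_uniq ?size_rev //.
  - exact: path_rcons_rev.
  - by move=> z; rewrite mem_rev => /sA.
  - by exists (val v), (val u); split=> //; [rewrite setUC|move=> z; rewrite mem_rev].
exists val, (fun u v => rcons (inner (val u) (val v)) (val v)).
have internalE (u v : W) : H u v ->
    internal (rcons (inner (val u) (val v)) (val v)) (val v) = [set z in inner (val u) (val v)].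
  case/innerP => _ _ _ sA _; apply/setP => z; rewrite !inE mem_rcons inE.
  case: eqVneq => [->|] /=; rewrite ?andbT ?andbF //.
  by apply/esym/negP => /sA /AnT; rewrite (valP v).
split; first exact: val_inj.
  move=> u v uv; rewrite internalE //; have [pQ uQ sQ QA _] := innerP u v uv.
  split=> //; first by rewrite last_rcons.
  - by rewrite size_rcons ltnS (leq_trans sQ).
  - rewrite /= rcons_uniq uQ mem_rcons inE andbT negb_or -andbA; apply/and3P; split.
    + by rewrite (inj_eq val_inj); apply/eqP => e; rewrite e (adj_irr H) in uv.
    + by apply/negP => /QA /AnT; rewrite (valP u).
    + by apply/negP => /QA /AnT; rewrite (valP v).
  - apply/pred0P => z /=; rewrite !inE; apply/negP => /andP[/QA /AnT zT /imsetP[w _ e]].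
    by rewrite e (valP w) in zT.
move=> u v u' v' uv uv' neq; rewrite !internalE //.
have [_ _ _ _ [x [y [xyE e1 i1]]]] := innerP u v uv.
have [_ _ _ _ [x' [y' [xyE' e2 i2]]]] := innerP u' v' uv'.
apply/pred0P => z /=; rewrite !inE i1 i2; apply/negP => /andP[zi zi'].
have [ex ey] := Edisj _ _ _ _ _ xyE xyE' zi zi'.
case/negP: neq; apply/eqP/(imset_inj val_inj).
by rewrite !imsetU !imset_set1 e1 e2 ex ey.
Qed.

End Linkages.

Lemma path_join (V : finType) (G : sgraph V) x y z p q :
  path G x (rcons p y) -> path G z (rcons q y) ->
  path G x (rcons (p ++ y :: rev q) z).
Proof.
move=> pp pq; rewrite rcons_cat rcons_cons -cat_rcons cat_path pp last_rcons.
exact: path_rcons_rev.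
Qed.

(** The first term bounds the neighbours of the chosen vertex in the first system. The second bounds
    the paths it starts in the second system, each contributing at most [R] interior vertices and
    its end. *)
Definition separator_bound c R := 2 * c + c * (1 + 2 * R * c * (2 * c + 1)) * R.+1.

Lemma exists_separator (V : finType) (G : sgraph V) c R (S : {set V}) :
  (forall (W : finType) (H : sgraph W),
     shallow_top_minor (2 * R) G H -> 2 * nedges H <= c * #|W|) ->
  S != set0 ->
  exists2 v, v \in S & exists2 U : {set V}, #|U| <= separator_bound c R &
    forall p, path G v p -> size p <= R -> v \notin p -> has (mem S) p -> has (mem U) p.
Proof.
move=> dens S0.
(* The bound [2 * R] leaves room for two paths of the second kind joined at a common vertex. *)
have [E [s [lE maxE]]] := exists_max_linkage G (2 * R) (~: S) (setX S S).
have [ED Es _] := lE.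
have ES x y : (x, y) \in E -> (x \in S) && (y \in S).
  by move/(subsetP ED); rewrite inE.
have cE : 2 * #|E| <= c * #|S|.
  apply: (linkage_density dens _ _ _ lE) => //.
  by rewrite disjoint_sym disjoints_subset setCK.
pose M := \bigcup_(e in E) [set z in s e.1 e.2].
have SM x : x \in S -> x \notin M.
  move=> xS; apply/bigcupP => -[[a b] abE]; rewrite inE /= => zs.
  by have [_ _ _ _ /(_ _ zs)] := Es a b abE; rewrite inE xS.
have cM : #|M| <= 2 * R * #|E|.
  apply: leq_trans (leq_card_bigcup _ _) _.
  rewrite mulnC -sum_nat_const; apply: leq_sum => -[a b] abE /=.
  rewrite cardsE; apply: leq_trans (card_size _) _.
  by have [] := Es a b abE.
pose nbr v := [set w | ((v, w) \in E) || ((w, v) \in E)].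
have nbr_sum : \sum_(v in S) #|nbr v| <= c * #|S|.
  apply: leq_trans cE; rewrite mul2n -addnn.
  apply: leq_trans (leq_add (sum_card_fibers S E fst) (sum_card_fibers S E snd)).
  rewrite -big_split /=; apply: leq_sum => v _.
  apply: leq_trans (_ : #|snd @: [set e in E | e.1 == v] :|: fst @: [set e in E | e.2 == v]| <= _).
    apply: subset_leq_card; apply/subsetP => w; rewrite !inE => /orP[vw|wv]; apply/orP.
      by left; apply/imsetP; exists (v, w); rewrite ?inE ?vw ?eqxx.
    by right; apply/imsetP; exists (w, v); rewrite ?inE ?wv ?eqxx.
  by apply: leq_trans (leq_card_setU _ _) _; apply: leq_add; apply: leq_imset_card.
pose L := [set v in S | #|nbr v| <= 2 * c].
have cL : #|S| <= 2 * #|L| by apply: card_below_average nbr_sum.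
(* By maximality [I] and its neighbours cover [L], where degrees are at most [2 * c]; hence [I]
   contains a constant fraction of [S]. *)
pose indep (I : {set V}) := (I \subset L) && [forall x in I, forall y in I, (x, y) \notin E].
have [|I /maxsetP[/andP[IL indI] maxI] _] := @maxset_exists _ indep set0.
  by rewrite /indep sub0set; apply/forall_inP => x; rewrite inE.
have {}indI x y : x \in I -> y \in I -> (x, y) \notin E.
  by move=> xI yI; have /forall_inP/(_ x xI)/forall_inP/(_ y yI) := indI.
have IS x : x \in I -> x \in S by move/(subsetP IL); rewrite inE => /andP[].
have cI : #|L| <= (2 * c + 1) * #|I|.
  apply: leq_trans (_ : #|I :|: \bigcup_(y in I) nbr y| <= _).
    apply: subset_leq_card; apply/subsetP => x xL; rewrite inE.
    have [//|xI /=] := boolP (x \in I); apply: contraR xI => xN.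
    have xNE y : y \in I -> ((x, y) \notin E) && ((y, x) \notin E).
      move=> yI; rewrite -negb_or; apply: contra xN => xy; apply/bigcupP; exists y => //.
      by rewrite inE orbC.
    have xxE : (x, x) \notin E.
      by apply/negP => xxE; have [] := Es x x xxE; rewrite xxE.
    rewrite -(maxI (x |: I)); first by rewrite setU11.
      rewrite /indep subUset sub1set xL IL /=.
      apply/forall_inP => a /setU1P[->|aI]; apply/forall_inP => b /setU1P[->|bI] //.
      - by have /andP[] := xNE b bI.
      - by have /andP[] := xNE a aI.
      - exact: indI.
    exact: subsetUr.
  apply: leq_trans (leq_card_setU _ _) _; rewrite mulnDl mul1n addnC leq_add2r.
  apply: leq_trans (leq_card_bigcup _ _) _; rewrite mulnC -sum_nat_const.
  by apply: leq_sum => y /(subsetP IL); rewrite inE => /andP[].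
have I0 : I != set0.
  by move: S0; rewrite -!card_gt0; nia.
have [E' [s' [lE' maxE']]] := exists_max_linkage G R (~: (S :|: M)) (setX I M).
have [ED' Es' _] := lE'.
have ES' x y : (x, y) \in E' -> (x \in I) && (y \in M).
  by move/(subsetP ED'); rewrite inE.
have cE' : 2 * #|E'| <= c * #|I :|: M|.
  apply: (linkage_density dens _ _ _ lE'); first by lia.
    by apply/subsetP => -[x y]; rewrite !inE /= => /andP[-> ->]; rewrite orbT.
  rewrite disjoint_sym disjoints_subset setCK; apply/subsetP => x.
  by rewrite !inE => /orP[/IS ->|->]; rewrite ?orbT.
(* [D0] bounds the average number of paths per vertex of [I]: there are at most [c * (#|I| + #|M|)]
   paths, and [M] is linear in [S], hence in [I]. *)
set D0 := c * (1 + 2 * R * c * (2 * c + 1)).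
have [|v vI cv] := @exists_leq_average _ I (fun v => #|[set e in E' | e.1 == v]|) D0 I0.
  apply: leq_trans (sum_card_fibers I E' fst) _.
  have cIM : #|I :|: M| <= #|I| + #|M| by rewrite leq_card_setU.
  have h1 : #|M| <= R * (c * #|S|) by apply: leq_trans cM _; rewrite mulnAC mulnC leq_mul2l cE orbT.
  have h2 : #|S| <= 2 * ((2 * c + 1) * #|I|) by apply: leq_trans cL _; rewrite leq_mul2l cI orbT.
  have h3 : #|M| <= R * (c * (2 * ((2 * c + 1) * #|I|))).
    by apply: leq_trans h1 _; rewrite !leq_mul2l h2 !orbT.
  have h4 : #|E'| <= c * (#|I| + #|M|).
    have : c * #|I :|: M| <= c * (#|I| + #|M|) by rewrite leq_mul2l cIM orbT.
    by lia.
  apply: leq_trans h4 _; rewrite /D0 -mulnA leq_mul2l; apply/orP; right.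
  rewrite mulnDl mul1n leq_add2l; apply: leq_trans h3 _; apply: eq_leq; lia.
exists v; first exact: IS.
pose out := [set e in E' | e.1 == v].
exists (nbr v :|: \bigcup_(e in out) (e.2 |: [set z in s' e.1 e.2])).
  apply: leq_trans (leq_card_setU _ _) _; apply: leq_add.
    by move/(subsetP IL): vI; rewrite inE => /andP[].
  apply: leq_trans (leq_card_bigcup _ _) _.
  apply: leq_trans (_ : \sum_(e in out) R.+1 <= _); last first.
    by rewrite sum_nat_const leq_mul2r cv orbT.
  apply: leq_sum => -[a b]; rewrite inE => /andP[/Es'[_ _ _ sab _] _] /=.
  apply: leq_trans (leq_card_setU _ _) _; rewrite cards1 add1n ltnS cardsE.
  exact: leq_trans (card_size _) sab.
set U := _ :|: _ => p pp sp vp pS.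
have pSM : has (mem (S :|: M)) p by apply: sub_has pS => x /= xS; rewrite inE xS.
(* The walk is cut at its first vertex [z] in [S :|: M]; [q] is the part between [v] and [z]. *)
apply: contraT => /hasPn pU; case/split_find: pSM sp vp pp pU {pS} => z q p2 zSM qSM sp vp pp pU.
have {pp} pq : path G v (rcons q z) by move: pp; rewrite cat_path => /andP[].
have vz : v != z.
  by apply: contraNneq vp => ->; rewrite mem_cat mem_rcons inE eqxx.
have sq : size q < R by apply: leq_trans sp; rewrite size_cat size_rcons leq_addr.
have zU : z \notin U by apply: pU; rewrite mem_cat mem_rcons inE eqxx.
have qU x : x \in q -> x \notin U.
  by move=> xq; apply: pU; rewrite mem_cat mem_rcons inE xq orbT.
have {}qSM : {subset q <= ~: (S :|: M)}.
  by move=> x xq; rewrite inE; apply: (hasPn qSM).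
(* A path through the complement of [S :|: M] joining two vertices of [S]
   could be added to the maximum linkage. *)
have joinE a q' : a \in S -> v != a -> path G v (rcons q' a) -> size q' <= 2 * R ->
    {subset q' <= ~: (S :|: M)} -> a \in nbr v.
  move=> aS va pq' sq' q'SM; rewrite inE; apply: (maxE v a q') => //.
  - by rewrite inE /= aS IS.
  - by move=> x /q'SM; rewrite !inE negb_or => /andP[].
  move=> x y w xyE /q'SM; rewrite !inE negb_or => /andP[_]; apply: contra => ws.
  by apply/bigcupP; exists (x, y); rewrite ?inE.
case/setUP: zSM => [zS|zM].
  by rewrite inE (joinE z q) // (leq_trans (ltnW sq)) // leq_pmull in zU.
(* Otherwise [q] meets a path of the second system, from some [a] in [I]. If [a = v], that path lies
   in [U]; if not, joining the two pieces makes [v] and [a] neighbours, against the independence of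
   [I]. *)
have : ((v, z) \in E') || ((z, v) \in E').
  apply: (maxE' v z q) => //; first by rewrite inE /= vI.
    exact: ltnW.
  move=> a b y abE' yq; apply/negP => ys.
  have /andP[aI bM] := ES' _ _ abE'.
  have [av|av] := eqVneq v a.
    have := qU y yq; rewrite inE negb_or => /andP[_ /bigcupP[]].
    by exists (a, b); rewrite ?inE ?abE' ?av ?eqxx //= ys orbT.
  have [_ pab _ sab sabA] := Es' a b abE'.
  have [q1 [pq1 sq1 q1q]] := path_prefix pq yq.
  have [q2 [pq2 sq2 q2s]] := path_prefix pab ys.
  have : a \in nbr v.
    apply: (joinE a (q1 ++ y :: rev q2)) => //; first exact: IS.
    - exact: path_join.
    - rewrite size_cat /= size_rev mul2n -addnn leq_add // ?(leq_trans sq2 sab) //.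
      exact: ltnW (ltn_trans sq1 sq).
    - move=> x; rewrite mem_cat inE mem_rev => /or3P[/q1q /qSM//|/eqP ->|/q2s /sabA//].
      exact: qSM.
  by rewrite inE (negPf (indI _ _ vI aI)) (negPf (indI _ _ aI vI)).
case/orP => [vzE|/ES'/andP[_]]; last by rewrite (negPf (SM v (IS _ vI))).
case/negP: zU; rewrite inE; apply/orP; right; apply/bigcupP.
by exists (v, z); rewrite !inE ?vzE ?eqxx.
Qed.

(* The vertices are ranked from the top down, each time removing one supplied by
   [exists_separator] for the set of vertices not ranked yet. *)
Lemma separating_order (V : finType) (G : sgraph V) R K :
  (forall S : {set V}, S != set0 ->
    exists2 v, v \in S & exists2 U : {set V}, #|U| <= K &
    forall p, path G v p -> size p <= R -> v \notin p -> has (mem S) p -> has (mem U) p) ->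
  exists f : V -> nat, injective f /\ forall v, exists2 U : {set V}, #|U| <= K &
    forall p, path G v p -> size p <= R -> v \notin p ->
      has (fun u => f u < f v) p -> has (mem U) p.
Proof.
move=> sep.
(* For the induction the ranking is relative to a set [S], with ranks below [#|S|], so that a
   removed vertex can take the top rank. *)
suff [f [finj _ fU]] : exists f : V -> nat, [/\ {in [set: V] &, injective f},
    forall v, v \in [set: V] -> f v < #|[set: V]|
  & forall v, v \in [set: V] -> exists2 U : {set V}, #|U| <= K &
    forall p, path G v p -> size p <= R -> v \notin p ->
      has (fun u => (u \in [set: V]) && (f u < f v)) p -> has (mem U) p].
  exists f; split=> [x y|v]; first by apply: finj; rewrite inE.
  have [|U cU hU] := fU v; first by rewrite inE.
  exists U => // p pp sp vp hp; apply: hU => //.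
  by apply: sub_has hp => u /= ->; rewrite inE.
move: [set: V] => S; have [n] := ubnP #|S|; elim: n S => // n IH S.
rewrite ltnS => Sn; have [->|S0] := eqVneq S set0.
  by exists (fun _ => 0); split=> [x|x|x]; rewrite inE.
have [v vS [U cU hU]] := sep S S0.
have cS : #|S| = #|S :\ v|.+1 by rewrite (cardsD1 v) vS.
have [|f [finj fS fU]] := IH (S :\ v); first by rewrite -cS.
pose g u := if u == v then #|S :\ v| else f u.
have gv : g v = #|S :\ v| by rewrite /g eqxx.
have gf u : u != v -> g u = f u by rewrite /g => /negPf ->.
have flt u : u \in S -> u != v -> f u < #|S :\ v|.
  by move=> uS uv; apply: fS; rewrite !inE uv.
exists g; split.
- move=> x y xS yS; have [->|xv] := eqVneq x v; have [->|yv] := eqVneq y v => //.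
  + by rewrite gv gf // => e; have := flt y yS yv; rewrite -e ltnn.
  + by rewrite gv gf // => e; have := flt x xS xv; rewrite e ltnn.
  + by rewrite !gf // => /finj; apply; rewrite !inE ?xv ?yv.
- move=> x xS; rewrite cS ltnS; have [->|xv] := eqVneq x v; first by rewrite gv.
  by rewrite gf // ltnW // flt.
move=> x xS; have [->|xv] := eqVneq x v.
  exists U => // p pp sp vp hp; apply: hU => //.
  by apply: sub_has hp => u /= /andP[].
have [|U' cU' hU'] := fU x; first by rewrite !inE xv.
exists U' => // p pp sp xp hp; apply: hU' => //; apply: sub_has hp => u /= /andP[uS].
rewrite (gf x) //; have [->|uv] := eqVneq u v.
  by rewrite gv ltnNge (ltnW (flt x xS xv)).
by rewrite gf // !inE uv uS.
Qed.

(** * The cops' strategy along a separating order *)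

Section ClosureStrategy.
Variables (V : finType) (G : sgraph V) (U : V -> {set V}).

Fixpoint sep_closure n v : {set V} :=
  if n is m.+1 then v |: \bigcup_(w in U v) sep_closure m w else [set v].

Lemma card_sep_closure K n v : (forall v, #|U v| <= K) ->
  #|sep_closure n v| <= K.+1 ^ n.
Proof.
move=> cU; elim: n v => [|n IH] v /=; first by rewrite cards1.
apply: leq_trans (leq_card_setU _ _) _; rewrite cards1 expnS mulSn leq_add ?expn_gt0 //.
apply: leq_trans (leq_card_bigcup _ _) _.
apply: leq_trans (_ : \sum_(w in U v) K.+1 ^ n <= _); first exact: leq_sum.
by rewrite sum_nat_const leq_mul2r cU orbT.
Qed.

Lemma sep_closure_refl n v : v \in sep_closure n v.
Proof. by case: n => [|n]; rewrite !inE eqxx. Qed.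

Variables (f : V -> nat) (R : nat).
Hypothesis f_inj : injective f.
Hypothesis U_sep : forall v p, path G v p -> size p <= R -> v \notin p ->
  has (fun u => f u < f v) p -> has (mem (U v)) p.

(* [sep_closure n v] contains every vertex weakly [n]-reachable from [v]: if the path is
   nontrivial it meets [U v], and we continue from there. *)
Lemma mem_sep_closure n v p : path G v p -> size p <= n -> n <= R ->
  all (fun z => f (last v p) <= f z) (v :: p) -> last v p \in sep_closure n v.
Proof.
move=> pp; case/shortenP: pp => q pq uq sub.
move=> sp nR minp.
have {minp} minq : all (fun z => f (last v q) <= f z) (v :: q).
  move: minp => /= /andP[-> /allP minp]; apply/allP => z /sub; exact: minp.
have {sp sub} sq : size q <= n.
  by apply: leq_trans sp; apply: uniq_leq_size => //; case/andP: uq.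
elim: n v q pq uq sq nR minq {p} => [|n IH] v q pq uq sq nR minq.
  by move: sq; rewrite leqn0 => /nilP ->; rewrite inE.
have [->|q0] := eqVneq q [::]; first exact: sep_closure_refl.
have vq : v \notin q by case/andP: uq.
have lq : last v q \in q by case: (q) q0 => //= a p _; rewrite mem_last.
(* The end of [q] is lowest and, [q] being simple and nonempty, differs from [v]; so it ranks
   strictly below [v]. *)
have : has (mem (U v)) q.
  apply: U_sep => //; first exact: leq_trans sq nR.
  apply/hasP; exists (last v q) => //; rewrite ltn_neqAle.
  have /andP[-> _] := minq; rewrite andbT (inj_eq f_inj).
  by apply: contraNneq vq => <-.
case/hasP => y yq yU; rewrite /= inE; apply/orP; right; apply/bigcupP; exists y => //.
move: pq uq sq minq {vq lq q0}; case/splitPr: yq => p1 p2.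
rewrite last_cat /= cat_path => /andP[_ /andP[_ pp2]] /andP[_].
rewrite cat_uniq size_cat addnS ltnS => /and3P[_ _ up2] sp.
rewrite all_cat => /and3P[_ _ minp2].
by apply: IH; rewrite ?(ltnW nR) // (leq_trans _ sp) // leq_addl.
Qed.

End ClosureStrategy.

(* The cops occupy [sep_closure U (2 * r) v], where [v] is the robber's last position.
   The lowest vertex of the robber's current walk then increases from round to round:
   otherwise the next minimum is weakly reachable from both the previous and the current
   position, so it is occupied before and after the move and the robber cannot cross it. *)
Lemma separating_order_cops_win (V : finType) (G : sgraph V) r K (U : V -> {set V})
    (f : V -> nat) :
  injective f -> (forall v, #|U v| <= K) ->
  (forall v p, path G v p -> size p <= 2 * r -> v \notin p ->
     has (fun u => f u < f v) p -> has (mem (U v)) p) ->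
  cops_win G (Some r) (K.+1 ^ (2 * r)).
Proof.
move=> finj cU Usep; pose N := sep_closure U (2 * r).
(* Only the robber's last position matters; the default [set0] concerns the empty history, which no
   play produces. *)
exists (fun h => last set0 [seq N e.2 | e <- h]); split.
  case/lastP=> [|h e]; first by rewrite cards0.
  by rewrite map_rcons last_rcons card_sep_closure.
move=> Ss vs [_ play]; exfalso.
have SsE i : Ss i.+1 = N (vs i).
  by have [-> _] := play i; case: i => // i; rewrite cop_histS map_rcons last_rcons.
have /choice[P PP] : forall i, exists p,
    [/\ path G (vs i) p, last (vs i) p = vs i.+1, size p <= r
      & all (fun z => z \notin Ss i :&: Ss i.+1) (vs i :: p)].
  by move=> i; have [_ [p ?]] := play i; exists p.
have /choice[u uP] : forall i, exists u, u \in vs i :: P i /\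
    forall z, z \in vs i :: P i -> f u <= f z.
  move=> i; have vi : vs i \in vs i :: P i by rewrite inE eqxx.
  by case: (arg_minnP f vi) => u ui umin; exists u.
have ascend i : f (u i) < f (u i.+1).
  rewrite ltnNge; apply/negP => fu.
  have [pp lp sp _] := PP i; have [pp' _ sp' avoid] := PP i.+1.
  have [_ umin] := uP i; have [u'P umin'] := uP i.+1.
  have /negP[] := allP avoid _ u'P; rewrite inE !SsE.
  (* [p1] leads from [vs i.+1] to [u i.+1]. Preceded by [P i] it has length at most [2 * r], and by
     [fu] its lowest vertex is [u i.+1]. *)
  case/splitPl: u'P pp' sp' umin' {avoid} => p1 p2 lp1.
  rewrite cat_path size_cat => /andP[pp1 _] sp1 umin'.
  have {}sp1 : size p1 <= r by apply: leq_trans sp1; apply: leq_addr.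
  have umin1 z : z \in vs i.+1 :: p1 -> f (u i.+1) <= f z.
    by move=> zp; apply: umin'; rewrite -cat_cons mem_cat zp.
  have lpp1 : last (vs i) (P i ++ p1) = u i.+1 by rewrite last_cat lp.
  rewrite -{1}lpp1 -lp1 !(@mem_sep_closure _ G U f (2 * r)) //.
  - by rewrite (leq_trans sp1) // leq_pmull.
  - by apply/allP => z; rewrite lp1; apply: umin1.
  - by rewrite cat_path pp lp.
  - by rewrite size_cat mul2n -addnn leq_add.
  apply/allP => z; rewrite lpp1 -cat_cons mem_cat => /orP[/umin|zp].
    exact: leq_trans.
  by apply: umin1; rewrite inE zp orbT.
(* Strictly increasing ranks would exceed the maximum of [f]. *)
have lower i : i <= f (u i) by elim: i => // i /leq_ltn_trans; apply.
have := lower (\max_v f v).+1.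
by rewrite ltnNge (leq_bigmax (F := f)).
Qed.

Lemma bounded_expansion_flip_width (C : graph_class) :
  bounded_expansion C -> bounded_flip_width C.
Proof.
(* The cops need separators for radius [2 * r], and these need density at twice that depth. *)
move=> hC r; have [c hc] := hC (2 * (2 * r)).
pose k := (separator_bound c (2 * r)).+1 ^ (2 * r).
exists (k + 2 ^ k) => V G CG; apply: fw_leq_exp.
have [f [finj fU]] := separating_order (fun S => exists_separator (hc V G CG) (S := S)).
have /choice[U UP] : forall v, exists U : {set V}, #|U| <= separator_bound c (2 * r) /\
    forall p, path G v p -> size p <= 2 * r -> v \notin p ->
      has (fun u => f u < f v) p -> has (mem U) p.
  by move=> v; have [U ? ?] := fU v; exists U.
by apply: (separating_order_cops_win finj (U := U)) => v; have [] := UP v.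
Qed.

Lemma fw_leq_cuts (V : finType) (G : sgraph V) r :
  fw G r <= copw G r + (\sum_(i < Ktt_number G) 'C(copw G r, i)
                        + (Ktt_number G).-1 * 'C(copw G r, Ktt_number G)).
Proof.
apply/fw_leq/(cops_win_flipper_wins _ (cops_win_copw G r)) => S Sk.
have Kfree : ~~ has_Ktt G (Ktt_number G) by rewrite /Ktt_number; case: ex_minnP.
apply: leq_add => //; apply: leq_trans (card_outer_traces S Kfree) _.
apply: leq_add; last by rewrite leq_mul2l leq_bin2l ?orbT.
by apply: leq_sum => i _; apply: leq_bin2l.
Qed.

Theorem mainTheorem4 :
  (forall (r : radius), r <> Some 0 ->
   forall (V : finType) (G : sgraph V), 0 < #|V| ->
     [/\ Ktt_number G <= copw G (Some 1),
         copw G (Some 1) <= copw G r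
       & 3 <= Ktt_number G -> fw G r <= copw G r ^ Ktt_number G])
  /\ (exists a b : nat,
        forall (r : radius), r <> Some 0 ->
        forall (V : finType) (G : sgraph V),
          Ktt_number G = 2 -> fw G r <= a * copw G r ^ Ktt_number G + b)
  /\ (forall C : graph_class, bounded_expansion C -> bounded_flip_width C).
Proof.
split; last split; last exact: bounded_expansion_flip_width.
  move=> r r0 V G V0; have t1 := Ktt_number_leq_copw1 G V0; have cr := copw1_leq G r0.
  split=> // t3; apply: leq_trans (fw_leq_cuts G r) _.
  by apply: card_cut_leq_exp => //; apply: leq_trans t1 cr.
(* For [t = 2] and [k] cops the bound is [k + (1 + k + 'C(k, 2))], where [k] and ['C(k, 2)] are at
   most [k ^ 2]. *)
exists 3, 1 => r _ V G t2; apply: leq_trans (fw_leq_cuts G r) _.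
rewrite t2 !big_ord_recr big_ord0 /= bin0 bin1.
by have := ffact_leq_exp (copw G r) 2; rewrite -bin_ffact (_ : 2`! = 2) // -mulnn; nia.
Qed.
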